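(* Let $\Lambda=\{\Lambda_i\}_{i\in I}$ and $\Gamma=\{\Gamma_i\}_{i\in I}$ be g-frames for $\mathcal H$ with respect to $\{\mathcal K_i\}_{i\in I}$, let $A_\Lambda$ be a lower g-frame bound of $\Lambda$, and let $U=\mathrm{diag}\{u_i\}_{i\in I}$ be a semi-normalized bounded diagonal operator on $\ell^2(\oplus_{i\in I}\mathcal K_i)$. For any $\Lambda'=\{\Lambda'_i\}_{i\in I}$ which is a $\mu$-perturbation of $\Lambda$ with $\mu<\sqrt{A_\Lambda}$, there exists a g-Bessel sequence $\Gamma'=\{\Gamma'_i\}_{i\in I}$ for $\mathcal H$ with respect to $\{\mathcal K_i\}_{i\in I}$ which is a $\lambda\mu$-perturbation of $\Gamma$ for some $\lambda>0$ and satisfies $$M_{U,\Lambda',\Gamma'}=M_{U,\Lambda,\Gamma}.$$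
   Context: $\mathcal H,\mathcal K$ are separable Hilbert spaces, $I\subseteq\mathbb Z$, and $\{\mathcal K_i\}_{i\in I}$ is a sequence of closed subspaces of $\mathcal K$. $\ell^2(\oplus_{i\in I}\mathcal K_i)$ is the Hilbert space of sequences $\{x_i\}_{i\in I}$ with $x_i\in\mathcal K_i$ and $\sum_i\|x_i\|^2<\infty$, with inner product $\langle\{x_i\},\{y_i\}\rangle=\sum_i\langle x_i,y_i\rangle$. A sequence $\Lambda=\{\Lambda_i\}_{i\in I}$ with $\Lambda_i\in B(\mathcal H,\mathcal K_i)$ is a g-frame for $\mathcal H$ with respect to $\{\mathcal K_i\}$ if there are constants $A_\Lambda,B_\Lambda>0$ (lower and upper g-frame bounds) with $A_\Lambda\|x\|^2\le\sum_{i}\|\Lambda_ix\|^2\le B_\Lambda\|x\|^2$ for all $x\in\mathcal H$; it is a g-Bessel sequence if only the upper inequality is required. For a g-Bessel sequence, the synthesis operator is the bounded operator $T_\Lambda:\ell^2(\oplus_i\mathcal K_i)\to\mathcal H$, $T_\Lambda\{x_i\}=\sum_i\Lambda_i^*x_i$, with adjoint $T_\Lambda^*x=\{\Lambda_ix\}_{i\in I}$. A sequence $\Lambda'=\{\Lambda'_i\}$ with $\Lambda'_i\in B(\mathcal H,\mathcal K_i)$ (with bounded synthesis operator $T_{\Lambda'}$) is a $\mu$-perturbation of $\Lambda$ if $\|T_\Lambda-T_{\Lambda'}\|\le\mu$ (operator norm). $U=\mathrm{diag}\{u_i\}_{i\in I}$, $u_i\in B(\mathcal K_i)$, denotes the bounded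 operator $\{x_i\}\mapsto\{u_ix_i\}$ on $\ell^2(\oplus_i\mathcal K_i)$. It is semi-normalized if every $u_i$ is invertible and $\{x_i\}\mapsto\{u_i^{-1}x_i\}$ is a bounded operator on $\ell^2(\oplus_i\mathcal K_i)$. For g-Bessel sequences $\Lambda,\Gamma$, the generalized multiplier is $M_{U,\Lambda,\Gamma}=T_\Lambda UT_\Gamma^*\in B(\mathcal H)$. *)

(* Defs.v *)
From HB Require Import structures.
From mathcomp Require Import all_boot all_order all_algebra.
From mathcomp Require Import finmap complex.
From mathcomp Require Import all_classical all_reals all_analysis.
From mathcomp.analysis.showcase Require summability.
Import Order.TTheory GRing.Theory Num.Theory.
Import numFieldNormedType.Exports.

Set Implicit Arguments.
Unset Strict Implicit.
Unset Printing Implicit Defensive.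

Local Open Scope classical_set_scope.
Local Open Scope ring_scope.

(* Hilbert spaces are taken over either of the two usual scalar fields. *)
Variant scalar_kind := RealScalars | ComplexScalars.

Definition scalars (R : realType) (k : scalar_kind) : numFieldType :=
  match k with RealScalars => R | ComplexScalars => R[i] end.

Definition sconj (R : realType) (k : scalar_kind) : scalars R k -> scalars R k :=
  match k with RealScalars => id | ComplexScalars => @conjc R end.

Definition sre (R : realType) (k : scalar_kind) : scalars R k -> R :=
  match k with RealScalars => id | ComplexScalars => @complex.Re R end.

(* The inner product is linear in its first argument. *)
Structure hilbertType (R : realType) (k : scalar_kind) := HilbertType {
  hilbert_sort :> completeNormedModType (scalars R k);
  inner : {dot hilbert_sort for @sconj R k};
  inner_norm : forall x : hilbert_sort, inner x x = `|x| ^+ 2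
}.
Arguments inner {R k h}.

Definition separable (T : topologicalType) :=
  exists D : set T, countable D /\ dense D.

Section Hilbert.
Context {R : realType} {k : scalar_kind}.
Implicit Types V W H K : hilbertType R k.

(* The library norm takes its values in the scalar field, where it is real;
   this is the same norm, as an element of R. *)
Definition hnorm V (x : V) : R := sre `|x|.

Definition closed_subspace V (D : set V) :=
  closed D /\ submod_closed [in D].

(* T restricts to an element of B(D, E); its values outside D are irrelevant. *)
Definition bounded_op V W (D : set V) (E : set W) (T : V -> W) :=
  [/\ forall x, D x -> E (T x),
      forall (a : scalars R k) x y, D x -> D y ->
        T (a *: x + y) = a *: T x + T y
    & exists M : R, forall x, D x -> hnorm (T x) <= M * hnorm x].

(* Hilbert-space adjoint, by its defining relation. When T takes its values in
   a closed subspace E, the adjoint of T as an operator into E is the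
   restriction of [adjoint T] to E. *)
Definition adjoint V W (T : V -> W) (y : W) : V :=
  xget 0 [set z | forall x, inner (T x) y = inner x z].

Section Index.
Variables (I : set int) (H K : hilbertType R k) (Ks : I -> set K).

Definition l2 : set (I -> K) := [set x |
  (forall i, Ks i (x i)) /\
  (\esum_(i in [set: I]) (hnorm (x i) ^+ 2)%:E < +oo)%E].

Definition l2norm (x : I -> K) : R :=
  Num.sqrt (fine (\esum_(i in [set: I]) (hnorm (x i) ^+ 2)%:E)).

Definition op_family (L : I -> H -> K) :=
  forall i, bounded_op [set: H] (Ks i) (L i).

Definition lower_gbound (L : I -> H -> K) (A : R) := 0 < A /\
  forall x : H, ((A * hnorm x ^+ 2)%:E <=
    \esum_(i in [set: I]) (hnorm (L i x) ^+ 2)%:E)%E.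

Definition upper_gbound (L : I -> H -> K) (B : R) := 0 < B /\
  forall x : H, (\esum_(i in [set: I]) (hnorm (L i x) ^+ 2)%:E <=
    (B * hnorm x ^+ 2)%:E)%E.

Definition gframe (L : I -> H -> K) :=
  [/\ op_family L, exists A, lower_gbound L A & exists B, upper_gbound L B].

Definition gbessel (L : I -> H -> K) :=
  op_family L /\ exists B, upper_gbound L B.

(* Unordered sum over I: limit of the finite partial sums in the norm of H. *)
Definition synthesis (L : I -> H -> K) (x : I -> K) : H :=
  summability.sum (fun i => adjoint (L i) (x i)).

(* T_L^*, the adjoint of the synthesis operator T_L of a g-Bessel sequence. *)
Definition analysis (L : I -> H -> K) (x : H) : I -> K := fun i => L i x.

Definition bounded_synthesis (L : I -> H -> K) :=
  (forall x, l2 x -> cvg (summability.partial_sum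
     (fun i => adjoint (L i) (x i)) @ summability.totally)) /\
  exists M : R, forall x, l2 x -> hnorm (synthesis L x) <= M * l2norm x.

Definition opnorm (T : (I -> K) -> H) : \bar R :=
  ereal_sup [set (hnorm (T x))%:E | x in [set x | l2 x /\ l2norm x <= 1]].

(* [perturbation mu L L']: L' is a mu-perturbation of L. *)
Definition perturbation (mu : R) (L L' : I -> H -> K) :=
  [/\ op_family L', bounded_synthesis L' &
      (opnorm (synthesis L \- synthesis L')%R <= mu%:E)%E].

Definition diag (u : I -> K -> K) (x : I -> K) : I -> K := fun i => u i (x i).

Definition bounded_diag (u : I -> K -> K) :=
  (forall i, bounded_op (Ks i) (Ks i) (u i)) /\
  exists M : R, forall x, l2 x ->
    l2 (diag u x) /\ l2norm (diag u x) <= M * l2norm x.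

(* The condition on v pins it to u_i^-1 on K_i. *)
Definition semi_normalized (u : I -> K -> K) :=
  exists v : I -> K -> K,
    (forall i x, Ks i x -> v i (u i x) = x /\ u i (v i x) = x) /\
    bounded_diag v.

Definition multiplier (u : I -> K -> K) (L G : I -> H -> K) (x : H) : H :=
  synthesis L (diag u (analysis G x)).

End Index.
End Hilbert.

(* Main.v *)
(* Write T_L for the synthesis operator of L. The operator P = T_Lam' T_Lam^* is
   coercive: with n = |T_Lam^* h| >= sqrt A |h|,
     Re <P h, h> >= n ^ 2 - mu n |h| >= sqrt A (sqrt A - mu) |h| ^ 2,
   hence invertible by Lax-Milgram. The perturbed family is given by
     T_Gam'^* = T_Gam^* + U^-1 T_Lam^* P^-1 (T_Lam - T_Lam') U T_Gam^*,
   so that T_Lam' U T_Gam'^* = T_Lam' U T_Gam^* + (T_Lam - T_Lam') U T_Gam^*.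
   The correction has norm O(mu), and so has its adjoint T_Gam' - T_Gam; that
   bound is obtained by duality on finite partial sums. *)
Require Import Defs.
From mathcomp Require Import all_boot all_order all_algebra.
From mathcomp Require Import finmap complex.
From mathcomp Require Import all_classical all_reals all_analysis.
From mathcomp.analysis.showcase Require summability.
From mathcomp Require Import ring lra.
Import Order.TTheory GRing.Theory Num.Theory.
Import numFieldNormedType.Exports.

Set Implicit Arguments.
Unset Strict Implicit.
Unset Printing Implicit Defensive.

Local Open Scope classical_set_scope.
Local Open Scope ring_scope.

#[local] Existing Instance summability.totally_filter.

(* Both scalar fields are handled at once through the real inner product [rin];
   [rsc] embeds R into the scalars. *)
Section RealScalars.
Context {R : realType} {k : scalar_kind}.
Implicit Types V W : hilbertType R k.

(** * Real numbers inside the scalar field *)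

Definition rsc : R -> scalars R k :=
  match k with RealScalars => id | ComplexScalars => real_complex R end.

Lemma sreD (a b : scalars R k) : sre (a + b) = sre a + sre b.
Proof. by rewrite /sre; destruct k => //=; case: a b => [a a'] [b b']. Qed.

Lemma sre_rscM r (a : scalars R k) : sre (rsc r * a) = r * sre a.
Proof.
rewrite /sre /rsc; destruct k => //=.
by case: a => [a a'] /=; rewrite mul0r subr0.
Qed.

Lemma rscK r : sre (rsc r) = r.
Proof. by rewrite /sre /rsc; destruct k. Qed.

Lemma rsc1 : rsc 1 = 1.
Proof. by rewrite /rsc; destruct k. Qed.

Lemma rscD r s : rsc (r + s) = rsc r + rsc s.
Proof. by rewrite /rsc; destruct k => //=; rewrite rmorphD. Qed.

Lemma rscN r : rsc (- r) = - rsc r.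
Proof. by rewrite /rsc; destruct k => //=; rewrite rmorphN. Qed.

Lemma ge0_rsc (a : scalars R k) : 0 <= a -> a = rsc (sre a).
Proof.
rewrite /rsc /sre; destruct k => //=.
by case: a => [a a']; rewrite lecE /= => /andP[/eqP -> _].
Qed.

Lemma le_rsc r s : (rsc r <= rsc s) = (r <= s).
Proof. by rewrite /rsc; destruct k => //=; rewrite lecR. Qed.

Lemma lt_rsc r s : (rsc r < rsc s) = (r < s).
Proof. by rewrite /rsc; destruct k => //=; rewrite ltcR. Qed.

Lemma rsc0 : rsc 0 = 0.
Proof. by rewrite /rsc; destruct k. Qed.

Lemma norm_rsc V (x : V) : `|x| = rsc (hnorm x).
Proof. exact: ge0_rsc. Qed.

Lemma sre_conj (a : scalars R k) : sre (sconj a) = sre a.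
Proof. by rewrite /sre /sconj; destruct k => //; case: a. Qed.

(** Over the complex numbers, c = 1 recovers the real part and c = i the imaginary part up to
    sign. *)
Lemma scalars_eqP (a b : scalars R k) :
  (forall c, sre (c * a) = sre (c * b)) -> a = b.
Proof.
rewrite /sre; destruct k => /=.
  by move=> /(_ 1); rewrite !mul1r.
case: a b => [a a'] [b b'] ab.
have := ab 1; rewrite !mul1r /= => ->.
have /= := ab 'i%C; rewrite !mul0r !mul1r !sub0r => /oppr_inj -> //.
Qed.

Lemma normr_rsc r : `|rsc r| = rsc `|r|.
Proof.
rewrite /rsc; destruct k => //=.
by rewrite normc_def /= expr0n /= addr0 sqrtr_sqr.
Qed.

(** * The real inner product and the real-valued norm *)

Definition rin V (x y : V) : R := sre (inner x y).

Lemma innerDl V (x y z : V) : inner (x + y) z = inner x z + inner y z.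
Proof. exact: linearDl. Qed.

Lemma innerZl V a (x z : V) : inner (a *: x) z = a * inner x z.
Proof. exact: linearZl_LR. Qed.

Lemma innerDr V (x y z : V) : inner z (x + y) = inner z x + inner z y.
Proof. exact: linearDr. Qed.

Lemma innerZr V a (x z : V) : inner z (a *: x) = sconj a * inner z x.
Proof. exact: linearZr_LR. Qed.

Lemma rinC V (x y : V) : rin x y = rin y x.
Proof.
have e : inner x y = (-1) ^+ false * sconj (inner y x).
  exact: hermitian_subproof.
by rewrite /rin e expr0 mul1r sre_conj.
Qed.

Lemma rinDl V (x y z : V) : rin (x + y) z = rin x z + rin y z.
Proof. by rewrite /rin innerDl sreD. Qed.

Lemma rinDr V (x y z : V) : rin z (x + y) = rin z x + rin z y.
Proof. by rewrite /rin innerDr sreD. Qed.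

Lemma rinZl V r (x z : V) : rin (rsc r *: x) z = r * rin x z.
Proof. by rewrite /rin innerZl sre_rscM. Qed.

Lemma rinZr V r (x z : V) : rin z (rsc r *: x) = r * rin z x.
Proof. by rewrite rinC rinZl rinC. Qed.

Lemma rinNl V (x z : V) : rin (- x) z = - rin x z.
Proof. by rewrite -scaleN1r -rsc1 -rscN rinZl mulN1r. Qed.

Lemma rinNr V (x z : V) : rin z (- x) = - rin z x.
Proof. by rewrite rinC rinNl rinC. Qed.

Lemma rinBl V (x y z : V) : rin (x - y) z = rin x z - rin y z.
Proof. by rewrite rinDl rinNl. Qed.

Lemma rinBr V (x y z : V) : rin z (x - y) = rin z x - rin z y.
Proof. by rewrite rinDr rinNr. Qed.

Lemma rin0l V (z : V) : rin 0 z = 0.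
Proof. by rewrite -(subrr 0) rinBl subrr. Qed.

Lemma rin_suml V (T : Type) (s : seq T) (f : T -> V) z :
  rin (\sum_(i <- s) f i) z = \sum_(i <- s) rin (f i) z.
Proof.
elim: s => [|a s IH]; first by rewrite !big_nil rin0l.
by rewrite !big_cons rinDl IH.
Qed.

Lemma rin_id V (x : V) : rin x x = hnorm x ^+ 2.
Proof.
rewrite /rin inner_norm norm_rsc expr2 sre_rscM.
by rewrite rscK.
Qed.

Lemma hnorm_ge0 V (x : V) : 0 <= hnorm x.
Proof. by rewrite -le_rsc -norm_rsc rsc0. Qed.

Lemma hnorm0 V : hnorm (0 : V) = 0.
Proof. by rewrite /hnorm normr0 -rsc0 rscK. Qed.

Lemma hnorm_eq0 V (x : V) : hnorm x = 0 -> x = 0.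
Proof. by move=> x0; apply/eqP; rewrite -normr_eq0 norm_rsc x0 rsc0. Qed.

Lemma hnormN V (x : V) : hnorm (- x) = hnorm x.
Proof. by rewrite /hnorm normrN. Qed.

Lemma hnormBC V (x y : V) : hnorm (x - y) = hnorm (y - x).
Proof. by rewrite -hnormN opprB. Qed.

Lemma hnormD V (x y : V) : hnorm (x + y) <= hnorm x + hnorm y.
Proof. by rewrite -le_rsc rscD -!norm_rsc ler_normD. Qed.

Lemma hnormZ V a (x : V) : hnorm (a *: x) = sre `|a| * hnorm x.
Proof. by rewrite /hnorm normrZ (@ge0_rsc `|a|) // sre_rscM rscK. Qed.

Lemma hnorm_rscZ V r (x : V) : hnorm (rsc r *: x) = `|r| * hnorm x.
Proof. by rewrite hnormZ normr_rsc rscK. Qed.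

Lemma hnormD_sq V (x y : V) :
  hnorm (x + y) ^+ 2 = hnorm x ^+ 2 + 2 * rin x y + hnorm y ^+ 2.
Proof. rewrite -!rin_id rinDl !rinDr (rinC y x); lra. Qed.

Lemma hnormB_sq V (x y : V) :
  hnorm (x - y) ^+ 2 = hnorm x ^+ 2 - 2 * rin x y + hnorm y ^+ 2.
Proof. rewrite hnormD_sq hnormN rinNr; lra. Qed.

(** Cauchy-Schwarz, obtained by squaring the triangle inequality. *)
Lemma rin_le V (x y : V) : rin x y <= hnorm x * hnorm y.
Proof.
have := hnormD x y; rewrite -(@ler_pXn2r _ 2) ?nnegrE ?addr_ge0 ?hnorm_ge0 //.
by rewrite hnormD_sq; lra.
Qed.

Lemma rin_inj V (x y : V) : (forall h, rin h x = rin h y) -> x = y.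
Proof.
move=> e; apply/eqP; rewrite -subr_eq0; apply/eqP/hnorm_eq0/eqP.
by rewrite -sqrf_eq0 -rin_id rinBr e subrr.
Qed.

(** Replacing h by c h for every scalar c turns the identity of real parts into an identity of
    scalars; this brings results on [rin] back to [inner]. *)
Lemma rin_inner V W (x : W) (z : V) (T : V -> W) :
    (forall a h, T (a *: h) = a *: T h) ->
    (forall h, rin (T h) x = rin h z) ->
  forall h, inner (T h) x = inner h z.
Proof.
move=> TZ e h; apply: scalars_eqP => c.
by rewrite -!innerZl -TZ; exact: e.
Qed.

(** * Limits along filters, measured by the real-valued norm *)

Lemma hnorm_cvgP V (T : Type) (F : set_system T) {FF : Filter F}
    (f : T -> V) (l : V) :
  f @ F --> l <-> forall e : R, 0 < e -> \forall x \near F, hnorm (l - f x) <= e.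
Proof.
split=> [/cvgrPdist_le fl e e0|fl].
  have /fl : 0 < rsc e by rewrite -rsc0 lt_rsc.
  by apply: filterS => x; rewrite norm_rsc le_rsc.
apply/cvgrPdist_le => e e0.
have ee : e = rsc (sre e) by rewrite -ge0_rsc // ltW.
have /fl : 0 < sre e by rewrite -lt_rsc rsc0 -ee.
by apply: filterS => x; rewrite norm_rsc ee le_rsc rscK.
Qed.

(** This is completeness: the centre l may change with e, so no candidate limit has to be known in
    advance. *)
Lemma hnorm_cauchy_cvg V (T : Type) (F : set_system T) {FF : ProperFilter F}
    (f : T -> V) :
  (forall e : R, 0 < e -> exists l, \forall x \near F, hnorm (l - f x) < e) ->
  cvg (f @ F).
Proof.
move=> fl; apply/cauchy_cvgP/cauchy_exP => e e0.
have ee : e = rsc (sre e) by rewrite -ge0_rsc // ltW.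
have /fl[l le] : 0 < sre e by rewrite -lt_rsc rsc0 -ee.
exists l; apply: filterS le => x.
by rewrite -ball_normE /= norm_rsc [in X in _ -> X]ee lt_rsc.
Qed.

Lemma hnorm_lim_le V (T : Type) (F : set_system T) {FF : ProperFilter F}
    (f : T -> V) (l : V) (C : R) :
  f @ F --> l -> (\forall x \near F, hnorm (f x) <= C) -> hnorm l <= C.
Proof.
move=> /hnorm_cvgP fl fC; apply/ler_addgt0Pr => e e0.
have [x [le xC]] := filter_ex (filterI (fl _ e0) fC).
rewrite -(subrK (f x) l); apply: le_trans (hnormD _ _) _.
by rewrite addrC lerD.
Qed.

Lemma rin_lim_ge V (T : Type) (F : set_system T) {FF : ProperFilter F}
    (f : T -> V) (l h : V) (C : R) :
  f @ F --> l -> (\forall x \near F, C <= rin (f x) h) -> C <= rin l h.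
Proof.
move=> /hnorm_cvgP fl fC; apply/ler_addgt0Pr => e e0.
have h0 := hnorm_ge0 h.
have d0 : 0 < e / (hnorm h + 1) by rewrite divr_gt0 //; lra.
have [x [le xC]] := filter_ex (filterI (fl _ d0) fC).
have := rin_le (f x - l) h; rewrite hnormBC rinBl => le2.
have : hnorm (l - f x) * hnorm h <= e / (hnorm h + 1) * (hnorm h + 1).
  by apply: ler_pM => //; rewrite ?hnorm_ge0 //; lra.
rewrite divfK; last by rewrite gt_eqF //; lra.
lra.
Qed.

(** * Riesz representation and the Lax-Milgram theorem *)

Lemma le0_of_le_small (a b : R) : (forall r, 0 < r -> a <= r * b) -> a <= 0.
Proof.
move=> ab; rewrite leNgt; apply/negP => a0.
have b1 : 0 < `|b| + 1 by have := normr_ge0 b; lra.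
(* This choice of r would give a (|b| + 1) <= a b, impossible for a > 0; the summand 1 keeps the
   denominator positive when b = 0. *)
have := ab (a / (`|b| + 1)) (divr_gt0 a0 b1).
rewrite mulrAC ler_pdivlMr //.
have : a * b <= a * `|b| by rewrite ler_pM2l // ler_norm.
nra.
Qed.

(* A minimizing filter of [B x x - 2 g x] is Cauchy by the parallelogram law. *)
Lemma lax_milgram_sym V (B : V -> V -> R) (g : V -> R) (c M N : R) :
    0 < c -> (forall x y, B x y = B y x) ->
    (forall x y z, B (x + y) z = B x z + B y z) ->
    (forall r x z, B (rsc r *: x) z = r * B x z) ->
    (forall x, c * hnorm x ^+ 2 <= B x x) ->
    (forall x y, B x y <= M * (hnorm x * hnorm y)) ->
    (forall x y, g (x + y) = g x + g y) ->
    (forall r x, g (rsc r *: x) = r * g x) ->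
    (forall x, g x <= N * hnorm x) ->
  exists z, forall h, B z h = g h.
Proof.
move=> c0 BC BDl BZl Bc BM gD gZ gN.
have BDr x y z : B z (x + y) = B z x + B z y by rewrite BC BDl !(BC z).
have BZr r x z : B z (rsc r *: x) = r * B z x by rewrite BC BZl BC.
have NE (x : V) : - x = rsc (- 1) *: x by rewrite rscN rsc1 scaleN1r.
pose J x := B x x - 2 * g x.
(* Completing the square in c |x|^2 - 2 N |x| gives the bound - N^2 / c. *)
have Jlow x : - (N ^+ 2 / c) <= J x.
  rewrite /J -subr_ge0.
  have -> : B x x - 2 * g x - - (N ^+ 2 / c) =
     (B x x - c * hnorm x ^+ 2) + 2 * (N * hnorm x - g x) +
     c * (hnorm x - N / c) ^+ 2 by field; lra.
  have := Bc x; have := gN x; have := sqr_ge0 (hnorm x - N / c); nra.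
have infJ : has_inf (range J).
  split; first by exists (J 0), 0.
  by exists (- (N ^+ 2 / c)) => _ [x _ <-].
pose d := inf (range J).
have dJ x : d <= J x by apply: ge_inf; [exact: infJ.2|exists x].
pose A (e : R) := [set x | J x < d + e].
pose F := filter_from [set e : R | 0 < e] A.
have FF : ProperFilter F.
  apply: filter_from_proper.
    apply: filter_from_filter; first by exists 1; rewrite /= ltr01.
    move=> e1 e2 /= e10 e20; exists (Num.min e1 e2); first by rewrite lt_min e10.
    move=> x; rewrite /A /= => xm; split; apply: lt_le_trans xm _.
      by rewrite lerD2l ge_min lexx.
    by rewrite lerD2l ge_min lexx orbT.
  move=> e /= e0; have [_ [x _ <-] xe] := inf_adherent e0 infJ.
  by exists x.
(* Parallelogram law for [B], combined with J >= d at the midpoint of x and y. *)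
have close e x y : A e x -> A e y -> c * hnorm (x - y) ^+ 2 <= 4 * e.
  rewrite /A /= => xe ye; apply: le_trans (Bc _) _.
  have := dJ (rsc 2^-1 *: (x + y)).
  rewrite /J BZl BZr gZ gD NE !BDl !BDr !BZl !BZr (BC y x).
  by move: xe ye; rewrite /J; lra.
have /cvg_ex[/= z Fz] : cvg (id @ F).
  apply: hnorm_cauchy_cvg => e e0.
  (* With this tolerance [close] yields c |x - y|^2 <= c e^2 / 2, which is strictly below c e^2. *)
  have e8 : 0 < c * e ^+ 2 / 8 by rewrite divr_gt0 // mulr_gt0 // exprn_gt0.
  have [_ [x _ <-] xe] := inf_adherent e8 infJ; exists x.
  exists (c * e ^+ 2 / 8) => //= y ye.
  have := close _ _ _ xe ye => h.
  rewrite -(@ltr_pXn2r _ 2) ?nnegrE ?hnorm_ge0 ?ltW //.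
  rewrite -(ltr_pM2l c0); lra.
move/hnorm_cvgP in Fz.
(* First variation at a near-minimizer x with J x < d + r^2 and |z - x| <= r: comparing with J (x +
   r h) >= d and dividing by r bounds g h - B x h by r (1 + B h h) / 2. Moving from x to z costs at
   most r |M| |h|, and r tends to 0. The reverse inequality comes from - h. *)
have main h : g h <= B z h.
  rewrite -subr_le0.
  apply: (@le0_of_le_small _ ((1 + B h h + 2 * (`|M| * hnorm h)) / 2)) => r r0.
  have Ar : F (A (r ^+ 2)) by exists (r ^+ 2) => //=; rewrite exprn_gt0.
  have [x [xr xz]] := filter_ex (filterI Ar (Fz _ r0)).
  have := dJ (x + rsc r *: h).
  move: xr; rewrite /A /= /J !BDl !BDr !BZl !BZr gD gZ (BC h x) => xr dx.
  have := BM (x - z) h; rewrite NE BDl BZl -NE hnormBC => Bxz.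
  have : M * (hnorm (z - x) * hnorm h) <= r * (`|M| * hnorm h).
    rewrite [leRHS]mulrCA mulrA [leRHS]mulrA.
    apply: ler_wpM2r; first exact: hnorm_ge0.
    apply: le_trans (_ : `|M| * hnorm (z - x) <= _).
      by apply: ler_wpM2r; [exact: hnorm_ge0|exact: ler_norm].
    by apply: ler_wpM2l.
  have : r * (g h - B x h) <= r * (r * (1 + B h h) / 2) by nra.
  rewrite ler_pM2l //; nra.
exists z => h; apply/eqP; rewrite eq_le main andbT.
have := main (- h); rewrite NE gZ BZr; lra.
Qed.

Lemma riesz V (g : V -> R) (N : R) :
    (forall x y, g (x + y) = g x + g y) ->
    (forall r x, g (rsc r *: x) = r * g x) ->
    (forall x, g x <= N * hnorm x) ->
  exists z, forall h, g h = rin h z.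
Proof.
move=> gD gZ gN.
have [|||x|x y|z zP] :=
    @lax_milgram_sym V (@rin V) g 1 1 N _ (@rinC V) _ _ _ _ gD gZ gN.
- exact: ltr01.
- exact: rinDl.
- exact: rinZl.
- by rewrite rin_id mul1r.
- by rewrite mul1r rin_le.
by exists z => h; rewrite rinC zP.
Qed.

Lemma coercive_le V (x y : V) (c : R) :
  c * hnorm x ^+ 2 <= rin y x -> c * hnorm x <= hnorm y.
Proof.
move=> cx; have [x0|x0] := eqVneq (hnorm x) 0; first by rewrite x0 mulr0 hnorm_ge0.
have xp : 0 < hnorm x by rewrite lt_neqAle eq_sym x0 hnorm_ge0.
rewrite -(ler_pM2r xp) -mulrA -expr2.
exact: le_trans cx (rin_le _ _).
Qed.

(** The symmetric case is applied to the normal equations <P z, P v> = <y, P v>, coercive with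
    constant c^2 because c |u| <= |P u|. Then P z - y is orthogonal to the range of P, in particular
    to P (P z - y), so coercivity at P z - y forces it to vanish. *)
Lemma lax_milgram V (P : V -> V) (c M : R) :
    0 < c ->
    (forall a x y, P (a *: x + y) = a *: P x + P y) ->
    (forall x, hnorm (P x) <= M * hnorm x) ->
    (forall x, c * hnorm x ^+ 2 <= rin (P x) x) ->
  forall y, exists x, P x = y.
Proof.
move=> c0 PL PM Pc y.
have P0 : P 0 = 0.
  by have := PL (-1) 0 0; rewrite scaler0 addr0 scaleN1r addrC subrr.
have PD u v : P (u + v) = P u + P v by rewrite -[u]scale1r PL !scale1r.
have PZ a u : P (a *: u) = a *: P u by rewrite -[a *: u]addr0 PL P0 addr0.
have Pc' x := coercive_le (Pc x).
have [|u v|u v w|r u v|u|u v|u v|r u|u|z zP] :=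
    @lax_milgram_sym V (fun u v => rin (P u) (P v)) (fun v => rin y (P v))
      (c ^+ 2) (M ^+ 2) (hnorm y * M).
- by rewrite exprn_gt0.
- exact: rinC.
- by rewrite PD rinDl.
- by rewrite PZ rinZl.
- rewrite rin_id -exprMn ler_pXn2r ?nnegrE ?mulr_ge0 ?hnorm_ge0 //.
  exact: ltW.
- apply: le_trans (rin_le _ _) _.
  rewrite (_ : M ^+ 2 * _ = (M * hnorm u) * (M * hnorm v)); last by ring.
  by apply: ler_pM => //; exact: hnorm_ge0.
- by rewrite PD rinDr.
- by rewrite PZ rinZr.
- apply: le_trans (rin_le _ _) _.
  by rewrite -mulrA ler_wpM2l // hnorm_ge0.
exists z; apply/eqP; rewrite -subr_eq0; apply/eqP/hnorm_eq0/eqP.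
have := Pc (P z - y); rewrite rinC rinBl zP subrr => h.
have : hnorm (P z - y) ^+ 2 <= 0 by rewrite -(ler_pM2l c0) mulr0.
by rewrite le_eqVlt ltNge sqr_ge0 orbF sqrf_eq0.
Qed.

(** Preimages are picked by choice; the lower bound c |x| <= |P x| makes them unique, hence linear
    in y, and bounds them by |y| / c. *)
Lemma coercive_inverse V (P : V -> V) (c M : R) : 0 < c ->
    (forall a x y, P (a *: x + y) = a *: P x + P y) ->
    (forall x, hnorm (P x) <= M * hnorm x) ->
    (forall x, c * hnorm x ^+ 2 <= rin (P x) x) ->
  exists Q : V -> V, [/\ forall y, P (Q y) = y,
    forall a x y, Q (a *: x + y) = a *: Q x + Q y
    & forall y, hnorm (Q y) <= c^-1 * hnorm y].
Proof.
move=> c0 PL PM Pc.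
have [Q PQ] := choice (lax_milgram c0 PL PM Pc).
have low x := coercive_le (Pc x).
have inj x y : P x = P y -> x = y.
  move=> e; apply/eqP; rewrite -subr_eq0; apply/eqP/hnorm_eq0/eqP.
  rewrite eq_le hnorm_ge0 andbT -(ler_pM2l c0) mulr0.
  have P0 : P (x - y) = 0 by rewrite addrC -scaleN1r PL e scaleN1r addNr.
  by have := low (x - y); rewrite P0 hnorm0.
exists Q; split=> // [a x y|y].
  by apply: inj; rewrite PL !PQ.
by rewrite mulrC ler_pdivlMr // mulrC -[in leRHS](PQ y).
Qed.

(** * Bounded operators and their adjoints *)

Lemma bounded_opD V W (D : set V) (E : set W) (T : V -> W) x y :
  bounded_op D E T -> D x -> D y -> T (x + y) = T x + T y.
Proof.
by move=> [_ TL _] Dx Dy; rewrite -[x]scale1r TL // !scale1r.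
Qed.

Lemma bounded_op0 V W (D : set V) (E : set W) (T : V -> W) :
  bounded_op D E T -> D 0 -> T 0 = 0.
Proof.
move=> [_ TL _] D0; have := TL (-1) 0 0 D0 D0.
by rewrite scaler0 addr0 scaleN1r addNr.
Qed.

Lemma bounded_opZ V W (D : set V) (E : set W) (T : V -> W) a x :
  bounded_op D E T -> D 0 -> D x -> T (a *: x) = a *: T x.
Proof.
move=> bT D0 Dx; rewrite -[a *: x]addr0; case: (bT) => _ TL _.
by rewrite TL // (bounded_op0 bT) // addr0.
Qed.

(** Riesz representation of h |-> <T h, y> shows that the set behind [adjoint] is inhabited, so
    [xget] returns a genuine adjoint value and not its default 0. *)
Lemma inner_adjoint V W (E : set W) (T : V -> W) :
  bounded_op [set: V] E T -> forall h y, inner (T h) y = inner h (adjoint T y).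
Proof.
move=> bT h y; case: (bT) => _ _ [M TM].
have [u v|r u|u|z zP] := @riesz V (fun h => rin (T h) y) (hnorm y * M).
- by rewrite (bounded_opD bT) // rinDl.
- by rewrite (bounded_opZ _ bT) // rinZl.
- apply: le_trans (rin_le _ _) _.
  by rewrite mulrC -mulrA ler_wpM2l ?hnorm_ge0 ?TM.
have Sz : exists z, [set z | forall x, inner (T x) y = inner x z] z.
  by exists z; apply: rin_inner zP => a u; rewrite (bounded_opZ _ bT).
by have /= -> := @xgetPex _ 0 _ Sz.
Qed.

Lemma rin_adjoint V W (E : set W) (T : V -> W) :
  bounded_op [set: V] E T -> forall h y, rin (T h) y = rin h (adjoint T y).
Proof. by move=> bT h y; rewrite /rin (inner_adjoint bT). Qed.

Lemma adjoint_linear V W (E : set W) (T : V -> W) :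
    bounded_op [set: V] E T ->
  forall a x y, adjoint T (a *: x + y) = a *: adjoint T x + adjoint T y.
Proof.
move=> bT a x y; apply: rin_inj => h.
by rewrite /rin innerDr innerZr -!(inner_adjoint bT) innerDr innerZr.
Qed.

(** * Finite square sums and duality *)

Definition sqsum (T : Type) V (x : T -> V) (s : seq T) : R :=
  \sum_(i <- s) hnorm (x i) ^+ 2.

Lemma sqsum_ge0 (T : Type) V (x : T -> V) s : 0 <= sqsum x s.
Proof. by apply: sumr_ge0 => i _; exact: sqr_ge0. Qed.

Lemma sqsumD_le (T : Type) V (x y : T -> V) s :
  sqsum (fun i => x i + y i) s <= 2 * sqsum x s + 2 * sqsum y s.
Proof.
rewrite /sqsum !mulr_sumr -big_split /=; apply: ler_sum => i _.
have := sqr_ge0 (hnorm (x i - y i)); rewrite hnormD_sq hnormB_sq; lra.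
Qed.

Lemma sqsumZ (T : Type) V a (x : T -> V) s :
  sqsum (fun i => a *: x i) s = sre `|a| ^+ 2 * sqsum x s.
Proof.
by rewrite /sqsum mulr_sumr; apply: eq_bigr => i _; rewrite hnormZ exprMn.
Qed.

Lemma sum_rin_le (T : Type) V (x y : T -> V) s :
  \sum_(i <- s) rin (x i) (y i) <= Num.sqrt (sqsum x s) * Num.sqrt (sqsum y s).
Proof.
elim: s => [|i s IH].
  by rewrite big_nil mulr_ge0 ?sqrtr_ge0.
rewrite big_cons /sqsum !big_cons -!/(sqsum _ s).
apply: le_trans (lerD (rin_le _ _) IH) _.
set u := hnorm _; set v := hnorm _.
have := sqsum_ge0 x s; have := sqsum_ge0 y s.
move: (sqsum x s) (sqsum y s) => a b b0 a0.
have u0 : 0 <= u := hnorm_ge0 _; have v0 : 0 <= v := hnorm_ge0 _.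
rewrite -(@ler_pXn2r _ 2) ?nnegrE ?addr_ge0 ?mulr_ge0 ?sqrtr_ge0 //.
rewrite [leRHS]exprMn !sqr_sqrtr ?addr_ge0 ?sqr_ge0 //.
(* This square is exactly the difference (u^2 + a) (v^2 + b) - (u v + sqrt a sqrt b)^2. *)
have := sqr_ge0 (Num.sqrt a * v - Num.sqrt b * u).
move: (sqr_sqrtr a0) (sqr_sqrtr b0).
move: (Num.sqrt a) (Num.sqrt b) => p q <- <-; nra.
Qed.

(* Duality: testing the sum against itself reduces the bound to [E]. *)
Lemma hnorm_sum_dual (T : Type) V W (E : T -> V -> W) (z : T -> V)
    (x : T -> W) (s : seq T) (c : R) :
    0 <= c -> (forall h i, rin (E i h) (x i) = rin h (z i)) ->
    (forall h, sqsum (E^~ h) s <= (c * hnorm h) ^+ 2) ->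
  hnorm (\sum_(i <- s) z i) <= c * Num.sqrt (sqsum x s).
Proof.
move=> c0 Ez Ec; set w := \sum_(i <- s) z i.
have w0 := hnorm_ge0 w.
have le : hnorm w ^+ 2 <= (c * Num.sqrt (sqsum x s)) * hnorm w.
  rewrite -rin_id {1}/w rin_suml.
  rewrite (eq_bigr (fun i => rin (E i w) (x i))); last first.
    by move=> i _; rewrite Ez rinC.
  apply: le_trans (sum_rin_le _ _ _) _.
  rewrite mulrAC; apply: ler_wpM2r; first exact: sqrtr_ge0.
  by rewrite -[leRHS]ger0_norm ?mulr_ge0 // -sqrtr_sqr ler_sqrt ?sqr_ge0.
have [->|w1] := eqVneq (hnorm w) 0; first by rewrite mulr_ge0 ?sqrtr_ge0.
by move: le; rewrite expr2 ler_pM2r // lt_neqAle eq_sym w1.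
Qed.

(** * The space of square-summable sequences *)

Section SquareSummable.
Variables (I : set int) (H K : hilbertType R k) (Ks : I -> set K).
Hypothesis closedK : forall i, closed_subspace (Ks i).
Implicit Types (x y : I -> K) (J : {fset I}) (L : I -> H -> K).

(** [\esum] is a supremum over finite subsets, so every upper bound on it can be checked on finite
    sums; all later estimates go through [sqsum] this way. *)
Lemma esum_leP (f : I -> R) (C : R) :
  (\esum_(i in [set: I]) (f i)%:E <= C%:E)%E <->
  forall J, \sum_(i <- J) f i <= C.
Proof.
split=> [fC J|fC].
  rewrite -lee_fin; apply: le_trans fC; apply: esum_ge.
  exists [set` J]; first by split => //; exact: finite_fset.
  by rewrite fsbig_finite ?finite_fset //= set_fsetK sumEFin.
apply: ge_ereal_sup => _ [X [Xfin _] <-].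
by rewrite fsbig_finite //= sumEFin lee_fin.
Qed.

Lemma esum_hnorm_ge0 x : (0 <= \esum_(i in [set: I]) (hnorm (x i) ^+ 2)%:E)%E.
Proof. by apply: esum_ge0 => i _; rewrite lee_fin sqr_ge0. Qed.

Lemma l2norm_ge0 x : 0 <= l2norm x.
Proof. exact: sqrtr_ge0. Qed.

Lemma l2norm_le x (c : R) :
  0 <= c -> (forall J, sqsum x J <= c ^+ 2) -> l2norm x <= c.
Proof.
move=> c0 /esum_leP xc.
rewrite /l2norm -[leRHS]ger0_norm // -sqrtr_sqr ler_sqrt ?sqr_ge0 //.
rewrite -lee_fin fineK // ge0_fin_numE ?esum_hnorm_ge0 //.
by rewrite (le_lt_trans xc) // ltry.
Qed.

Lemma l2_intro x (C : R) :
  (forall i, Ks i (x i)) -> (forall J, sqsum x J <= C) -> l2 Ks x.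
Proof.
by move=> xK /esum_leP xC; split=> //; apply: le_lt_trans xC _; exact: ltry.
Qed.

Lemma sqsum_le_l2norm x : l2 Ks x -> forall J, sqsum x J <= l2norm x ^+ 2.
Proof.
move=> [_ xfin]; apply/esum_leP; rewrite /l2norm sqr_sqrtr ?fine_ge0 ?esum_hnorm_ge0 //.
by rewrite fineK // ge0_fin_numE ?esum_hnorm_ge0.
Qed.

Lemma sqrt_sqsum_le x J : l2 Ks x -> Num.sqrt (sqsum x J) <= l2norm x.
Proof.
move=> xl; rewrite -[leRHS]ger0_norm ?l2norm_ge0 // -sqrtr_sqr.
by rewrite ler_sqrt ?sqr_ge0 // sqsum_le_l2norm.
Qed.

Lemma sum_fsetU (M : nmodType) (f : I -> M) (J0 J : {fset I}) :
  (J0 `<=` J)%fset ->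
  \sum_(i <- J) f i = \sum_(i <- J0) f i + \sum_(i <- (J `\` J0)%fset) f i.
Proof.
move=> sub; rewrite (big_fsetID _ (mem J0)) /=; congr (_ + _).
  apply: eq_fbigl => i; rewrite !inE /=.
  by rewrite andb_idl // => /(fsubsetP sub).
by apply: eq_fbigl => i; rewrite !inE /= andbC.
Qed.

(** Some finite J0 carries all but e of the squared norm, since otherwise the square root of
    [l2norm x ^+ 2 - e] would already bound the norm. *)
Lemma l2_tail x : l2 Ks x -> forall e : R, 0 < e ->
  exists J0 : {fset I}, forall J, (J0 `<=` J)%fset ->
    sqsum x (J `\` J0)%fset <= e.
Proof.
move=> xl e e0.
have [J0 J0P] : exists J0 : {fset I}, l2norm x ^+ 2 - e < sqsum x J0.
  apply: contrapT => /forallNP xJ.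
  have n0 := l2norm_ge0 x.
  have le J : sqsum x J <= l2norm x ^+ 2 - e by rewrite leNgt; apply/negP/xJ.
  have c0 : 0 <= l2norm x ^+ 2 - e by apply: le_trans (le fset0); exact: sqsum_ge0.
  have := @l2norm_le x (Num.sqrt (l2norm x ^+ 2 - e)) (sqrtr_ge0 _).
  rewrite sqr_sqrtr // => /(_ le).
  apply/negP; rewrite -ltNge -(@ltr_pXn2r _ 2) ?nnegrE ?sqrtr_ge0 // sqr_sqrtr //.
  lra.
exists J0 => J sub; have := sqsum_le_l2norm xl J.
have -> : sqsum x J = sqsum x J0 + sqsum x (J `\` J0)%fset by exact: sum_fsetU.
lra.
Qed.

(** * Unordered sums controlled by duality *)

Lemma partial_sumE (V : zmodType) (z : I -> V) J :
  summability.partial_sum z J = \sum_(i <- J) z i.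
Proof. by rewrite /summability.partial_sum big_seq_fsetE. Qed.

(** Beyond a suitable J0, partial sums differ from the one over J0 by a sum over J minus J0, which
    duality bounds by c times the tail of x. Here z i plays the role of the adjoint of E i at x i;
    leaving it abstract also covers differences of adjoints. *)
Lemma dual_cvg (E : I -> H -> K) (z : I -> H) x (c : R) :
    0 <= c -> (forall h i, rin (E i h) (x i) = rin h (z i)) ->
    (forall h J, sqsum (E^~ h) J <= (c * hnorm h) ^+ 2) -> l2 Ks x ->
  cvg (summability.partial_sum z @ summability.totally).
Proof.
move=> c0 Ez Ec xl; apply: hnorm_cauchy_cvg => e e0.
(* Dividing by c + 1 allows c = 0 and makes the final inequality strict. *)
have c1 : 0 < c + 1 by lra.
have d0 : 0 < e / (c + 1) by rewrite divr_gt0.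
have [J0 J0P] := l2_tail xl (exprn_gt0 2 d0).
exists (summability.partial_sum z J0).
exists J0 => // J sub.
rewrite hnormBC !partial_sumE (sum_fsetU _ sub) addrC addKr.
apply: le_lt_trans (hnorm_sum_dual c0 Ez (Ec^~ _)) _.
apply: le_lt_trans (_ : c * (e / (c + 1)) < _).
  apply: ler_wpM2l => //.
  rewrite -[leRHS]ger0_norm ?(ltW d0) // -sqrtr_sqr ler_sqrt ?sqr_ge0 //.
  exact: J0P.
have {2}-> : e = (c + 1) * (e / (c + 1)) by rewrite mulrC divfK ?gt_eqF.
by rewrite ltr_pM2r //; lra.
Qed.

Lemma dual_sum_le (E : I -> H -> K) (z : I -> H) x (c : R) (l : H) :
    0 <= c -> (forall h i, rin (E i h) (x i) = rin h (z i)) ->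
    (forall h J, sqsum (E^~ h) J <= (c * hnorm h) ^+ 2) -> l2 Ks x ->
  summability.partial_sum z @ summability.totally --> l ->
  hnorm l <= c * l2norm x.
Proof.
move=> c0 Ez Ec xl zl; apply: hnorm_lim_le zl _.
apply: nearW => J; rewrite partial_sumE.
apply: le_trans (hnorm_sum_dual c0 Ez (Ec^~ _)) _.
by rewrite ler_wpM2l // sqrt_sqsum_le.
Qed.

(** * Linear structure on sequences and the operator norm *)

Lemma closed_subspaceP i a (u v : K) : Ks i u -> Ks i v -> Ks i (a *: u + v).
Proof.
move=> Ku Kv; have [_ [_ lin]] := closedK i.
by have := lin a u v (mem_set Ku) (mem_set Kv); rewrite inE.
Qed.

Lemma closed_subspace0 i : Ks i 0.
Proof. by have [_ [z _]] := closedK i; rewrite inE in z. Qed.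

Lemma l2_0 : l2 Ks (fun=> 0).
Proof.
apply: (@l2_intro _ 0) => [i|J]; first exact: closed_subspace0.
by rewrite /sqsum big1 // => i _; rewrite hnorm0 expr0n.
Qed.

Lemma l2Z r x : l2 Ks x -> l2 Ks (fun i => rsc r *: x i).
Proof.
move=> xl; apply: (@l2_intro _ (r ^+ 2 * l2norm x ^+ 2)) => [i|J].
  rewrite -[_ *: _]addr0; apply: closed_subspaceP; [exact: xl.1|exact: closed_subspace0].
rewrite sqsumZ normr_rsc rscK real_normK ?num_real // ler_wpM2l ?sqr_ge0 //.
exact: sqsum_le_l2norm.
Qed.

Lemma l2norm_Z_le r x : l2 Ks x -> l2norm (fun i => rsc r *: x i) <= `|r| * l2norm x.
Proof.
move=> xl; apply: l2norm_le => [|J]; first by rewrite mulr_ge0 ?l2norm_ge0.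
rewrite sqsumZ normr_rsc rscK exprMn ler_wpM2l ?sqr_ge0 //.
exact: sqsum_le_l2norm.
Qed.

Lemma opnorm_le (T : (I -> K) -> H) (c : R) : 0 <= c ->
  (forall x, l2 Ks x -> hnorm (T x) <= c * l2norm x) -> (opnorm Ks T <= c%:E)%E.
Proof.
move=> c0 Tc; apply: ge_ereal_sup => _ [x [xl x1] <-]; rewrite lee_fin.
by apply: le_trans (Tc _ xl) _; rewrite ler_piMr.
Qed.

(** The zero sequence lies in the unit ball, so the supremum is over a nonempty set of nonnegative
    numbers. *)
Lemma opnorm_ge0 (T : (I -> K) -> H) (c : R) : (opnorm Ks T <= c%:E)%E -> 0 <= c.
Proof.
move=> Tc; apply: le_trans (hnorm_ge0 (T (fun=> 0))) _; rewrite -lee_fin.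
apply: le_trans Tc; apply: ereal_sup_ubound; exists (fun=> 0) => //; split; first exact: l2_0.
apply: l2norm_le => // J.
by rewrite /sqsum big1 // => i _; rewrite hnorm0 expr0n.
Qed.

Lemma opnorm_leP (T : (I -> K) -> H) (c : R) :
    (forall r x, l2 Ks x -> T (fun i => rsc r *: x i) = rsc r *: T x) ->
    (opnorm Ks T <= c%:E)%E ->
  forall x, l2 Ks x -> hnorm (T x) <= c * l2norm x.
Proof.
move=> TZ Tc x xl; have c0 := opnorm_ge0 Tc.
rewrite -subr_le0; apply: (@le0_of_le_small _ c) => r r0.
have n0 := l2norm_ge0 x.
(* Scaling x by the inverse of [l2norm x + r] lands in the unit ball even when the norm of x is 0;
   the excess c r disappears as r tends to 0. *)
have s0 : 0 < l2norm x + r by lra.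
have : hnorm (T (fun i => rsc (l2norm x + r)^-1 *: x i)) <= c.
  rewrite -lee_fin; apply: le_trans Tc; apply: ereal_sup_ubound.
  eexists; last by reflexivity.
  split; first exact: l2Z.
  apply: le_trans (l2norm_Z_le _ xl) _.
  by rewrite gtr0_norm ?invr_gt0 // mulrC ler_pdivrMr //; lra.
rewrite TZ // hnorm_rscZ gtr0_norm ?invr_gt0 // mulrC ler_pdivrMr //; lra.
Qed.

(** * Synthesis and analysis operators of g-Bessel families *)

Lemma synthesis_linear L a x y : op_family Ks L ->
    cvg (summability.partial_sum (fun i => adjoint (L i) (x i)) @ summability.totally) ->
    cvg (summability.partial_sum (fun i => adjoint (L i) (y i)) @ summability.totally) ->
  synthesis L (fun i => a *: x i + y i) = a *: synthesis L x + synthesis L y.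
Proof.
move=> opL cx cy; apply: cvg_lim; first exact: norm_hausdorff.
have -> : summability.partial_sum (fun i => adjoint (L i) (a *: x i + y i)) =
    (a \*: summability.partial_sum (fun i => adjoint (L i) (x i))) +
    summability.partial_sum (fun i => adjoint (L i) (y i)).
  apply/funext => J; rewrite fctE /= !partial_sumE scaler_sumr -big_split /=.
  by apply: eq_bigr => i _; rewrite (adjoint_linear (opL i)).
by apply: cvgD => //; apply: cvgZl_tmp.
Qed.

Lemma upper_gbound_sqsum L (B : R) : upper_gbound L B ->
  forall h J, sqsum (L^~ h) J <= (Num.sqrt B * hnorm h) ^+ 2.
Proof.
move=> [B0 LB] h; apply/esum_leP.
by rewrite exprMn sqr_sqrtr ?(ltW B0) //; exact: LB.
Qed.

Lemma op_familyE L h i : op_family Ks L -> Ks i (L i h).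
Proof. by move=> /(_ i)[+ _ _]; exact. Qed.

Lemma bessel_l2 L (c : R) h : op_family Ks L ->
  (forall h J, sqsum (L^~ h) J <= (c * hnorm h) ^+ 2) -> l2 Ks (analysis L h).
Proof.
by move=> opL Lc; apply: l2_intro (Lc h) => i; exact: op_familyE.
Qed.

Lemma bessel_l2norm L (c : R) h : 0 <= c ->
    (forall h J, sqsum (L^~ h) J <= (c * hnorm h) ^+ 2) ->
  l2norm (analysis L h) <= c * hnorm h.
Proof.
by move=> c0 Lc; apply: l2norm_le (Lc h); rewrite mulr_ge0 ?hnorm_ge0.
Qed.

Lemma bessel_cvg L (c : R) x : op_family Ks L -> 0 <= c ->
    (forall h J, sqsum (L^~ h) J <= (c * hnorm h) ^+ 2) -> l2 Ks x ->
  cvg (summability.partial_sum (fun i => adjoint (L i) (x i)) @ summability.totally).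
Proof.
move=> opL c0 Lc xl; apply: (dual_cvg c0 _ Lc xl) => h i.
exact: rin_adjoint (opL i) _ _.
Qed.

Lemma bessel_bounded_synthesis L (c : R) : op_family Ks L -> 0 <= c ->
    (forall h J, sqsum (L^~ h) J <= (c * hnorm h) ^+ 2) ->
  bounded_synthesis Ks L.
Proof.
move=> opL c0 Lc; split; first by move=> x; exact: bessel_cvg c0 Lc.
exists c => x xl; apply: (dual_sum_le c0 _ Lc xl (bessel_cvg opL c0 Lc xl)) => h i.
exact: rin_adjoint (opL i) _ _.
Qed.

Lemma gbessel_intro L (c : R) : 0 <= c -> (forall i h, Ks i (L i h)) ->
    (forall i a h h', L i (a *: h + h') = a *: L i h + L i h') ->
    (forall h J, sqsum (L^~ h) J <= (c * hnorm h) ^+ 2) ->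
  gbessel Ks L.
Proof.
move=> c0 LK Llin Lc; split.
  move=> i; split=> //; exists c => h _.
  (* The square-sum bound over a singleton bounds the single operator L i. *)
  have := Lc h [fset i]%fset; rewrite /sqsum big_seq_fset1.
  by rewrite ler_pXn2r ?nnegrE ?mulr_ge0 ?hnorm_ge0.
(* An upper g-frame bound must be positive, while c may be 0. *)
exists (c ^+ 2 + 1); split; first by have := sqr_ge0 c; lra.
move=> h; apply/esum_leP => J; apply: le_trans (Lc _ _) _.
by rewrite exprMn ler_wpM2r ?sqr_ge0 //; lra.
Qed.

(** Pairing the partial sums of T_L T_L^* h with h gives the finite sums of |L_i h|^2, which grow
    with the index set; each of them therefore stays below the limit. *)
Lemma l2norm_sq_le_rin L h : op_family Ks L ->
    l2 Ks (analysis L h) ->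
    cvg (summability.partial_sum (fun i => adjoint (L i) (analysis L h i))
      @ summability.totally) ->
  l2norm (analysis L h) ^+ 2 <= rin (synthesis L (analysis L h)) h.
Proof.
move=> opL Ll cL.
have le J0 : sqsum (analysis L h) J0 <= rin (synthesis L (analysis L h)) h.
  apply: rin_lim_ge cL _; exists J0 => // J sub.
  rewrite partial_sumE rin_suml.
  rewrite (eq_bigr (fun i => hnorm (L i h) ^+ 2)); last first.
    by move=> i _; rewrite rinC -(rin_adjoint (opL i)) rin_id.
  by rewrite (sum_fsetU _ sub) lerDl sqsum_ge0.
have r0 := le_trans (sqsum_ge0 _ _) (le fset0).
rewrite -(sqr_sqrtr r0) ler_pXn2r ?nnegrE ?l2norm_ge0 ?sqrtr_ge0 //.
by apply: l2norm_le; rewrite ?sqrtr_ge0 // => J; rewrite sqr_sqrtr.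
Qed.

Lemma lower_gbound_l2norm L (A : R) h : lower_gbound L A ->
  l2 Ks (analysis L h) -> Num.sqrt A * hnorm h <= l2norm (analysis L h).
Proof.
move=> [A0 LA] Ll.
rewrite -(@ler_pXn2r _ 2) ?nnegrE ?l2norm_ge0 ?mulr_ge0 ?sqrtr_ge0 ?hnorm_ge0 //.
rewrite exprMn sqr_sqrtr ?(ltW A0) // -lee_fin; apply: le_trans (LA h) _.
by apply/esum_leP; exact: sqsum_le_l2norm Ll.
Qed.

Lemma bounded_diagP (u : I -> K -> K) : bounded_diag Ks u ->
  exists2 M : R, 0 <= M & forall x, l2 Ks x ->
    l2 Ks (diag u x) /\ l2norm (diag u x) <= M * l2norm x.
Proof.
move=> [_ [M uM]]; exists `|M| => // x xl; have [ul le] := uM x xl.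
split=> //; apply: le_trans le _.
by rewrite ler_wpM2r ?l2norm_ge0 ?ler_norm.
Qed.

End SquareSummable.

End RealScalars.

(** * Construction of the perturbed family and its verification *)

Theorem theorem3p2 (R : realType) (k : scalar_kind) (H K : hilbertType R k)
  (sepH : separable H) (sepK : separable K)
  (I : set int) (Ks : I -> set K) (closedK : forall i, closed_subspace (Ks i))
  (Lam Gam : I -> H -> K) (u : I -> K -> K) (A : R)
  (frameL : gframe Ks Lam) (frameG : gframe Ks Gam) (lowerL : lower_gbound Lam A)
  (bddU : bounded_diag Ks u) (semiU : semi_normalized Ks u) :
  forall (Lam' : I -> H -> K) (mu : R),
    perturbation Ks mu Lam Lam' -> mu < Num.sqrt A ->
    exists Gam' : I -> H -> K, [/\ gbessel Ks Gam',
      exists lambda : R, 0 < lambda /\ perturbation Ks (lambda * mu) Gam Gam'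
      & forall x : H, multiplier u Lam' Gam' x = multiplier u Lam Gam x].
Proof.
move=> Lam' mu [opL' [cvL' [M' bdL']] opn] mu_lt.
have [opL _ [BL upL]] := frameL; have [opG _ [BG upG]] := frameG.
have mu0 := opnorm_ge0 closedK opn.
set bL := Num.sqrt BL; set bG := Num.sqrt BG.
have bL0 : 0 <= bL := sqrtr_ge0 _; have bG0 : 0 <= bG := sqrtr_ge0 _.
have sL : forall h (J : {fset I}), sqsum (Lam^~ h) J <= (bL * hnorm h) ^+ 2.
  exact: upper_gbound_sqsum upL.
have sG : forall h (J : {fset I}), sqsum (Gam^~ h) J <= (bG * hnorm h) ^+ 2.
  exact: upper_gbound_sqsum upG.
have Ll h := bessel_l2 h opL sL.
have Gl h := bessel_l2 h opG sG.
have Ln h := bessel_l2norm h bL0 sL.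
have Gn h := bessel_l2norm h bG0 sG.
have cvL x := bessel_cvg (x := x) opL bL0 sL.
have cvG x := bessel_cvg (x := x) opG bG0 sG.
have [v [uv [bv vM]]] := semiU.
have [Mv Mv0 {}vM] := bounded_diagP (conj bv vM).
have [Mu Mu0 uM] := bounded_diagP bddU.
have bu := bddU.1.
have SL' a x y : l2 Ks x -> l2 Ks y ->
    synthesis Lam' (fun i => a *: x i + y i) = a *: synthesis Lam' x + synthesis Lam' y.
  by move=> xl yl; apply: synthesis_linear opL' (cvL' _ xl) (cvL' _ yl).
pose D x := synthesis Lam x - synthesis Lam' x.
have DL a x y : l2 Ks x -> l2 Ks y -> D (fun i => a *: x i + y i) = a *: D x + D y.
  move=> xl yl; rewrite /D SL' // (synthesis_linear _ opL (cvL _ xl) (cvL _ yl)).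
  by rewrite scalerBr opprD addrACA.
have DZ r x : l2 Ks x -> D (fun i => rsc r *: x i) = rsc r *: D x.
  move=> xl; have x0 : l2 Ks (fun=> 0 : K) by apply: l2_0.
  have := DL (rsc r) x _ xl x0.
  have -> : D (fun=> 0) = 0.
    transitivity (D (fun i => -1 *: (0 : K) + 0)).
      by congr D; apply/funext => i; rewrite scaler0 addr0.
    by rewrite (DL _ _ _ x0 x0) scaleN1r addNr.
  rewrite addr0 => e; apply: etrans e; congr D; apply/funext => i.
  by rewrite addr0.
have Dmu := opnorm_leP closedK DZ opn.
have AL a h h' : analysis Lam (a *: h + h') = fun i => a *: Lam i h + Lam i h'.
  by apply/funext => i; case: (opL i) => _ lin _; exact: lin.
have AG a h h' : analysis Gam (a *: h + h') = fun i => a *: Gam i h + Gam i h'.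
  by apply/funext => i; case: (opG i) => _ lin _; exact: lin.
pose P h := synthesis Lam' (analysis Lam h).
have PL a h h' : P (a *: h + h') = a *: P h + P h'.
  rewrite /P AL SL' //; [exact: Ll|exact: Ll].
have PM h : hnorm (P h) <= (`|M'| * bL) * hnorm h.
  apply: le_trans (bdL' _ (Ll h)) _; rewrite -mulrA.
  apply: le_trans (_ : `|M'| * l2norm (analysis Lam h) <= _).
    by rewrite ler_wpM2r ?l2norm_ge0 ?ler_norm.
  by apply: ler_wpM2l; [exact: normr_ge0|exact: Ln].
have sA0 : 0 < Num.sqrt A by rewrite sqrtr_gt0 lowerL.1.
have c0 : 0 < Num.sqrt A * (Num.sqrt A - mu) by rewrite mulr_gt0 // subr_gt0.
have Pc h : Num.sqrt A * (Num.sqrt A - mu) * hnorm h ^+ 2 <= rin (P h) h.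
  have h0 := hnorm_ge0 h.
  have -> : P h = synthesis Lam (analysis Lam h) - D (analysis Lam h).
    by rewrite /D opprB addrC subrK.
  rewrite rinBl.
  have h1 := l2norm_sq_le_rin opL (Ll h) (cvL _ (Ll h)).
  have h2 := lower_gbound_l2norm lowerL (Ll h).
  have h3 := rin_le (D (analysis Lam h)) h.
  have h4 : hnorm (D (analysis Lam h)) * hnorm h <= mu * l2norm (analysis Lam h) * hnorm h.
    by apply: ler_wpM2r => //; apply: Dmu.
  (* With n the norm of T_Lam^* h, both factors of n (n - mu |h|) are minorized using n >= sqrt A
     |h|; the minorants are nonnegative because mu < sqrt A. *)
  have : (Num.sqrt A * hnorm h) * ((Num.sqrt A - mu) * hnorm h) <=
      l2norm (analysis Lam h) * (l2norm (analysis Lam h) - mu * hnorm h).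
    apply: ler_pM; rewrite ?mulr_ge0 ?(ltW sA0) ?subr_ge0 ?(ltW mu_lt) //.
    by rewrite mulrBl lerD2r.
  nra.
have [Q [PQ QL Qc]] := coercive_inverse c0 PL PM Pc.
set c := (_^-1) in Qc.
have cge0 : 0 <= c by rewrite invr_ge0 ltW.
pose W h := Q (D (diag u (analysis Gam h))).
have Ul h : l2 Ks (diag u (analysis Gam h)) := (uM _ (Gl h)).1.
have WL a h h' : W (a *: h + h') = a *: W h + W h'.
  rewrite /W -QL -DL //; congr (Q (D _)); apply/funext => i.
  by rewrite AG /diag; case: (bu i) => _ lin _; apply: lin; exact: (op_familyE _ _ opG).
(* The correction U^-1 T_Lam^* W, with W = P^-1 (T_Lam - T_Lam') U T_Gam^*, written
   componentwise. *)
pose N i h := v i (Lam i (W h)).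
have NL i a h h' : N i (a *: h + h') = a *: N i h + N i h'.
  rewrite /N WL; case: (opL i) => _ lin _; rewrite lin //.
  by case: (bv i) => _ linv _; apply: linv; exact: (op_familyE _ _ opL).
(* Product of the bounds for U^-1, T_Lam^*, P^-1, U and T_Gam^*; the remaining factor [D]
   contributes mu. *)
pose l0 := Mv * bL * c * Mu * bG.
have l00 : 0 <= l0 by rewrite !mulr_ge0.
have Nl h : l2 Ks (fun i => N i h) := (vM _ (Ll (W h))).1.
have Nn h : l2norm (fun i => N i h) <= l0 * mu * hnorm h.
  apply: le_trans (vM _ (Ll (W h))).2 _.
  rewrite (_ : l0 * mu * hnorm h = Mv * (bL * (c * (mu * (Mu * (bG * hnorm h)))))); last first.
    by rewrite /l0; ring.
  apply: ler_wpM2l => //; apply: le_trans (Ln _) _.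
  apply: ler_wpM2l => //; apply: le_trans (Qc _) _.
  apply: ler_wpM2l => //; apply: le_trans (Dmu _ (Ul h)) _.
  apply: ler_wpM2l => //; apply: le_trans (uM _ (Gl h)).2 _.
  by apply: ler_wpM2l => //; exact: Gn.
have sN h (J : {fset I}) : sqsum (N^~ h) J <= (l0 * mu * hnorm h) ^+ 2.
  apply: le_trans (sqsum_le_l2norm (Nl h) J) _.
  by rewrite ler_pXn2r ?nnegrE ?l2norm_ge0 ?mulr_ge0 ?hnorm_ge0.
pose Gam' i h := Gam i h + N i h.
have G'K i h : Ks i (Gam' i h).
  rewrite /Gam' -[Gam i h]scale1r; apply: closed_subspaceP => //.
    exact: (op_familyE _ _ opG).
  exact: (Nl h).1.
have G'L i a h h' : Gam' i (a *: h + h') = a *: Gam' i h + Gam' i h'.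
  rewrite /Gam' NL; case: (opG i) => _ -> // _.
  by rewrite scalerDr addrACA.
(* The constant comes from |a + b|^2 <= 2 |a|^2 + 2 |b|^2 applied to [Gam] and [N]. *)
pose c' := Num.sqrt (2 * bG ^+ 2 + 2 * (l0 * mu) ^+ 2).
have c'0 : 0 <= c' := sqrtr_ge0 _.
have c'2 : c' ^+ 2 = 2 * bG ^+ 2 + 2 * (l0 * mu) ^+ 2.
  by rewrite sqr_sqrtr // addr_ge0 // mulr_ge0 ?sqr_ge0.
have sG' h (J : {fset I}) : sqsum (Gam'^~ h) J <= (c' * hnorm h) ^+ 2.
  apply: le_trans (sqsumD_le _ _ _) _.
  have := sG h J; have := sN h J; rewrite (exprMn _ c') c'2; lra.
have bG' := gbessel_intro c'0 G'K G'L sG'.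
have opG' := bG'.1.
exists Gam'; split=> //.
  (* The 1 ensures a positive lambda, since l0 may be 0. *)
  exists (l0 + 1); split; first by lra.
  have bsG' := bessel_bounded_synthesis opG' c'0 sG'.
  split=> //; apply: opnorm_le => [|x xl]; first by rewrite mulr_ge0 //; lra.
  apply: le_trans (_ : l0 * mu * l2norm x <= _); last first.
    by rewrite ler_wpM2r ?l2norm_ge0 // ler_wpM2r //; lra.
  (* The difference of the adjoints of Gam_i and Gam'_i is dual to - N_i, so the bound l0 mu on the
     correction passes to T_Gam - T_Gam'. *)
  apply: (@dual_sum_le _ _ _ _ _ Ks (fun i h => - N i h)
    (fun i => adjoint (Gam i) (x i) - adjoint (Gam' i) (x i))) => //.
  - by rewrite mulr_ge0.
  - move=> h i; rewrite rinBr -(rin_adjoint (opG i)) -(rin_adjoint (opG' i)).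
    by rewrite /Gam' rinDl rinNl; lra.
  - move=> h J; rewrite (_ : sqsum _ _ = sqsum (N^~ h) J) //.
    by apply: eq_bigr => i _; rewrite hnormN.
  - have -> : summability.partial_sum
        (fun i => adjoint (Gam i) (x i) - adjoint (Gam' i) (x i)) =
        summability.partial_sum (fun i => adjoint (Gam i) (x i)) -
        summability.partial_sum (fun i => adjoint (Gam' i) (x i)).
      by apply/funext => J; rewrite partial_sumE sumrB -!partial_sumE.
    exact: cvgB (cvG x xl) (bsG'.1 x xl).
move=> h; rewrite /multiplier.
(* Since u_i cancels v_i, U T_Gam'^* h = U T_Gam^* h + T_Lam^* W h. Applying T_Lam' turns the last
   term into P (W h), which is (T_Lam - T_Lam') U T_Gam^* h. The factor 1 matches the form of
   [SL']. *)
have -> : diag u (analysis Gam' h) =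
    fun i => 1 *: diag u (analysis Gam h) i + analysis Lam (W h) i.
  apply/funext => i; rewrite scale1r /diag /analysis /Gam'.
  rewrite (bounded_opD (bu i)); [|exact: (op_familyE _ _ opG)|exact: (Nl h).1].
  by rewrite /N (uv i _ (op_familyE _ _ opL)).2.
by rewrite SL' // scale1r -/(P (W h)) PQ /D addrC subrK.
Qed.
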